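(* Let $T>0$, $x_0,y_0\in\mathbb{R}$, $\gamma_P,\gamma_A>0$, let $a^*$ be the constant action $a^*_t:=\kappa^*(1)$, $t\in[0,T]$, and set $$\beta^*:=\frac{T\gamma_A\gamma_P^2}{2(\gamma_A+\gamma_P)^2}+y_0+T\kappa(\kappa^*(1))-\frac{\gamma_P}{\gamma_A+\gamma_P}\left(x_0+T\kappa^*(1)\right).$$ (i) Let $W\in\mathcal{W}$, so that $(W,a^* )\in\mathcal{C}$. Then $(W,a^* )$ satisfies the Borch rule, i.e. there exists a constant $\alpha>0$ with $$\frac{U_P'\left(X_T^{a^*}-W\right)}{U_A'\left(W-\int_0^T\kappa(a^*_t)\,dt\right)}=\alpha\quad\mathbb{P}\text{-a.s.},$$ if and only if there exists $\beta\in\mathbb{R}$ such that $W=\frac{\gamma_P}{\gamma_A+\gamma_P}X_T^{a^*}+\beta$. Moreover, such a contract $\left(\frac{\gamma_P}{\gamma_A+\gamma_P}X_T^{a^*}+\beta,\,a^*\right)$ belongs to $\mathcal{C}_{PC}$ if and only if $\beta\ge\beta^*$. (ii) With $W^*:=\frac{\gamma_P}{\gamma_A+\gamma_P}X_T^{a^*}+\beta^*$, the contract $(W^*,a^* )$ belongs to $\mathcal{C}_{PC}$ and is optimal for the problem $\sup_{(W,a)\in\mathcal{C}_{PC}}\mathbb{E}[U_P(X_T^a-W)]$.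
   Context: Fix $T>0$. Let $(\Omega,\mathcal{F},\mathbb{P})$ be a probability space carrying a standard one-dimensional Brownian motion $B=(B_t)_{t\in[0,T]}$, and let $\mathbb{F}=(\mathcal{F}_t)_{t\in[0,T]}$ be its natural completed filtration. Let $\mathbb{H}_2$ be the set of $\mathbb{F}$-predictable processes $a=(a_t)_{t\in[0,T]}$ with values in $[0,\infty)$ such that $\mathbb{E}[\exp(q\int_0^T|a_t|^2dt)]<\infty$ for all $q>0$. For $a\in\mathbb{H}_2$ and a fixed $x_0\in\mathbb{R}$, set $X_t^a=x_0+\int_0^t a_s\,ds+B_t$. Let $\mathcal{W}$ be the set of $\mathcal{F}_T$-measurable random variables $W$ with $\mathbb{E}[\exp(qW)]<\infty$ for all $q\in\mathbb{R}\setminus\{0\}$, and $\mathcal{C}=\{(W,a):W\in\mathcal{W},a\in\mathbb{H}_2\}$. The cost function $\kappa:[0,\infty)\to\mathbb{R}$ is strictly convex, continuous, non-decreasing, with invertible derivative $\kappa'$; $\kappa^*(p)=\arg\sup_{x\ge0}(px-\kappa(x))=(\kappa')^{-1}(p)\ge0$ for $p\ge0$. With $\gamma_P,\gamma_A>0$, $U_P(x)=-\exp(-\gamma_P x)$ and $U_A(x)=-\exp(-\gamma_A x)$. For $y_0\in\mathbb{R}$, the participation constraint (PC) of a contract $(W,a)\in\mathcal{C}$ is $\mathbb{E}[U_A(W-\int_0^T\kappa(a_t)dt)]\ge U_A(y_0)$, and $\mathcal{C}_{PC}$ is the set of contracts in $\mathcal{C}$ satisfying the PC. *)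

(* Defs.v *)
From HB Require Import structures.
From mathcomp Require Import all_boot all_order all_algebra.
From mathcomp Require Import all_classical all_reals all_analysis.
Set Implicit Arguments. Unset Strict Implicit. Unset Printing Implicit Defensive.
Import Order.TTheory GRing.Theory Num.Theory.
Import numFieldNormedType.Exports.
Local Open Scope classical_set_scope.
Local Open Scope ring_scope.

Section Model.
Context {R : realType} {d : measure_display} {Omega : measurableType d}.
Variable P : probability Omega R.

Local Notation mu := (@lebesgue_measure R).

Definition is_null (N : set Omega) :=
  exists M, measurable M /\ N `<=` M /\ P M = 0%E.

(* standard one-dimensional Brownian motion on [0,T] under P:
   measurable marginals, B_0 = 0 a.s., a.s. continuous paths on [0,T],
   and for every 0 <= t_0 < t_1 < ... < t_n <= T the increments
   B_{t_{i+1}} - B_{t_i} are independent with law N(0, t_{i+1} - t_i)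
   (normal_prob m s has mean m and standard deviation s). *)
Definition std_BM (T : R) (B : R -> Omega -> R) :=
  [/\ (forall t, measurable_fun setT (B t)),
      {ae P, forall w, B 0 w = 0},
      {ae P, forall w, {within `[0, T], continuous (fun t => B t w)}} &
      (forall (n : nat) (ts : nat -> R) (A : nat -> set R),
         0 <= ts 0%N -> (forall i, (i < n)%N -> ts i < ts i.+1) -> ts n <= T ->
         (forall i, measurable (A i)) ->
         P (\bigcap_(i in [set i | (i < n)%N])
               [set w | A i (B (ts i.+1) w - B (ts i) w)]) =
         \big[*%E/1%E]_(i < n) normal_prob 0 (Num.sqrt (ts i.+1 - ts i)) (A i))].

Definition FB (B : R -> Omega -> R) (t : R) : set (set Omega) :=
  [set A | exists G,
     <<s [set: Omega],
         [set E | exists s U, 0 <= s <= t /\ measurable U /\ E = B s @^-1` U] >> G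
     /\ is_null ((A `\` G) `|` (G `\` A))].

Definition predictable_sets (T : R) (B : R -> Omega -> R) : set (set (R * Omega)) :=
  <<s `[0, T]%classic `*` [set: Omega],
      [set E | (exists F, FB B 0 F /\ E = [set 0] `*` F) \/
               (exists s t F, [/\ 0 <= s, s <= t, t <= T, FB B s F &
                                  E = `]s, t]%classic `*` F])] >>.

Definition predictable (T : R) (B : R -> Omega -> R) (a : R -> Omega -> R) :=
  forall U, measurable U ->
    predictable_sets T B [set p | `[0, T]%classic p.1 /\ U (a p.1 p.2)].

Definition H2 (T : R) (B : R -> Omega -> R) (a : R -> Omega -> R) :=
  [/\ predictable T B a,
      (forall t w, 0 <= t <= T -> 0 <= a t w) &
      (forall q : R, 0 < q ->
         (\int[P]_w expeR (q%:E * \int[mu]_(t in `[0%R, T]) ((a t w) ^+ 2)%:E)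
            < +oo)%E)].

Definition XT (x0 T : R) (B : R -> Omega -> R) (a : R -> Omega -> R) (w : Omega) : R :=
  x0 + fine (\int[mu]_(t in `[0%R, T]) (a t w)%:E)%E + B T w.

Definition Wadm (T : R) (B : R -> Omega -> R) (W : Omega -> R) :=
  (forall U, measurable U -> FB B T (W @^-1` U)) /\
  (forall q : R, q != 0 ->
     (\int[P]_w (expR (q * W w))%:E < +oo)%E).

Definition contractC (T : R) B (W : Omega -> R) a := Wadm T B W /\ H2 T B a.

Definition costI (kappa : R -> R) (T : R) (a : R -> Omega -> R) (w : Omega) : \bar R :=
  (\int[mu]_(t in `[0%R, T]) (kappa (a t w))%:E)%E.

Definition Uexp (gamma x : R) : R := - expR (- gamma * x).

Definition PC (gA y0 : R) (kappa : R -> R) (T : R) (W : Omega -> R) a :=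
  ((Uexp gA y0)%:E <=
     \int[P]_w (- expeR ((- gA)%:E * ((W w)%:E - costI kappa T a w))))%E.

Definition contractCPC (T : R) B (gA y0 : R) kappa (W : Omega -> R) a :=
  contractC T B W a /\ PC gA y0 kappa T W a.

Definition Jprincipal (gP x0 T : R) B (W : Omega -> R) a : \bar R :=
  (\int[P]_w (Uexp gP (XT x0 T B a w - W w))%:E)%E.

End Model.

(* Main.v *)
Require Import Defs.
From HB Require Import structures.
From mathcomp Require Import all_boot all_order all_algebra.
From mathcomp Require Import all_classical all_reals all_analysis.
From mathcomp Require Import measurable_realfun ring lra.
Import Order.TTheory GRing.Theory Num.Theory.
Import numFieldNormedType.Exports.
Local Open Scope classical_set_scope.
Local Open Scope ring_scope.

(**
Let [Z_P = X_T^a - W] and [Z_A = W - \int kappa(a)] be the net payoffs of the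
principal and of the agent. Their sum [x_0 + \int (a - kappa(a)) + B_T] is
maximal, path by path, for the constant action [kappa^*(1)]. At the candidate
contract the Borch rule says that the marginal utilities of the two parties are
proportional, so, by the tangent line inequality for [exp], the candidate
minimizes the Lagrangian [exp(-gP Z_P) + lam exp(-gA Z_A)] almost surely among
all contracts. Integrating and using the participation constraint, which binds
at [betastar], gives optimality. The value [betastar] itself comes from the
Gaussian moment generating function of [B_T].
*)

(** * Moment generating function of a Gaussian law *)

Lemma normal_pdf_tilt (R : realType) (m s q x : R) : s != 0 ->
  expR (q * x) * normal_pdf m s x =
  expR (q * m + q ^+ 2 * s ^+ 2 / 2) * normal_pdf (m + q * s ^+ 2) s x.
Proof.
move=> s0; rewrite !normal_pdfE// /normal_fun mulrCA [RHS]mulrCA -!expRD.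
(* Completing the square in the exponent. *)
by congr (_ * expR _); field.
Qed.

(** The Radon-Nikodym derivative of [normal_prob m s] and the explicit density have the same
    integral over every measurable set, hence agree almost everywhere. *)
Lemma ge0_integral_normal_prob (R : realType) (m s : R) (f : R -> \bar R) :
  measurable_fun setT f -> (forall x, 0 <= f x)%E ->
  (\int[normal_prob m s]_x f x =
   \int[lebesgue_measure]_x (f x * (normal_pdf m s x)%:E))%E.
Proof.
move=> mf f0.
have dom := normal_prob_dominates m s.
have mn : measurable_fun setT (EFin \o normal_pdf m s).
  by apply/measurable_EFinP; exact: measurable_normal_pdf.
have mg := measurable_int _ (charge.Radon_Nikodym_SigmaFinite.f_integrable dom).
rewrite -(charge.Radon_Nikodym_SigmaFinite.change_of_variables dom)//.
apply: ge0_ae_eq_integral => //.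
- exact: emeasurable_funM.
- exact: emeasurable_funM.
- move=> x _; apply: mule_ge0 => //.
  exact: charge.Radon_Nikodym_SigmaFinite.f_ge0.
- by move=> x _; apply: mule_ge0 => //; rewrite lee_fin normal_pdf_ge0.
- apply: ae_eqe_mul2l; apply: integral_ae_eq => //.
  + exact: charge.Radon_Nikodym_SigmaFinite.f_integrable.
  + by move=> E _ mE; rewrite -charge.Radon_Nikodym_SigmaFinite.f_integral.
Qed.

(** Tilting by [expR (q * x)] turns the density into a constant times another Gaussian density,
    whose integral is 1. *)
Lemma normal_prob_mgf (R : realType) (m s q : R) : s != 0 ->
  (\int[normal_prob m s]_x (expR (q * x))%:E =
   (expR (q * m + q ^+ 2 * s ^+ 2 / 2))%:E)%E.
Proof.
move=> s0.
have me : measurable_fun setT (fun x : R => (expR (q * x))%:E).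
  by apply/measurable_EFinP; apply: measurableT_comp => //; exact: mulrl_measurable.
rewrite (ge0_integral_normal_prob _ _ _ _ me) => [|x]; last first.
  by rewrite lee_fin expR_ge0.
under eq_integral do rewrite -EFinM normal_pdf_tilt// EFinM.
rewrite ge0_integralZl_EFin ?expR_ge0 ?integral_normal_pdf ?mule1// => [x _|].
  by rewrite lee_fin normal_pdf_ge0.
by apply/measurable_EFinP; exact: measurable_normal_pdf.
Qed.

Lemma measurable_expeR (R : realType) : measurable_fun setT (@expeR R).
Proof.
(* [er_map] fixes [-oo] whereas [expeR] sends it to 0, so this value is treated apart. *)
rewrite (_ : expeR = fun x => if x == -oo%E then 0%E else er_map expR x).
  apply: measurable_fun_ifT => //; last exact: (@measurable_er_map _ (measurableTypeR R)).
  apply: (measurable_fun_bool true).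
  have -> : (eq_op^~ -oo%E) @^-1` [set true] = [set -oo%E : \bar R].
    by apply/seteqP; split => x /= /eqP.
  by rewrite setTI; exact: emeasurable_set1.
by apply/funext => -[r| |].
Qed.

Lemma derive1_Uexp (R : realType) (g x : R) :
  derive1 (Uexp g) x = g * expR (- g * x).
Proof.
rewrite derive1E /Uexp.
have h : is_derive x 1 (fun y : R => - expR (- g * y)) (- (expR (- g * x) * - g)).
  apply: is_deriveN; apply: (@is_derive1_comp R expR (fun y => - g * y)).
  by apply: is_derive_eq; rewrite /GRing.scale/= mulr1.
by rewrite derive_val mulrN opprK mulrC.
Qed.

Section Model.
Context {R : realType} {d : measure_display} {Omega : measurableType d}.
Variable P : probability Omega R.
Local Notation mu := (@lebesgue_measure R).

(** * The law of the terminal value of the Brownian motion *)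

Section BrownianMarginal.
Variables (T : R) (B : R -> Omega -> R).
Hypotheses (hT : 0 < T) (hB : std_BM P T B).

Lemma std_BM_measurable t : measurable_fun setT (B t).
Proof. by case: hB. Qed.

Lemma std_BM_terminal_increment (A : set R) : measurable A ->
  P ((fun w => B T w - B 0 w) @^-1` A) = normal_prob 0 (Num.sqrt T) A.
Proof.
move=> mA; case: hB => _ _ _.
(* A grid with the single increment from 0 to [T]. *)
move=> /(_ 1%N (fun i => if i == 0%N then 0 else T) (fun=> A)).
rewrite /= big_ord_recl big_ord0 mule1/= subr0 => <- //; last by case.
congr (P _); apply/seteqP; split => w /=; first by move=> Aw [].
by move=> /(_ 0%N isT).
Qed.

Lemma std_BM_mgf (q : R) :
  (\int[P]_w (expR (q * B T w))%:E = (expR (q ^+ 2 * T / 2))%:E)%E.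
Proof.
have [mB B0 _ _] := hB.
(* [measurableTypeR R] has the same measurable sets as [R], but the display on
   which [normal_prob] is a measure. *)
have mD : measurable_fun setT (fun w => B T w - B 0 w : measurableTypeR R).
  exact: (measurable_funB (mB T) (mB 0)).
have me : measurable_fun setT (fun x : R => (expR (q * x))%:E).
  by apply/measurable_EFinP; apply: measurableT_comp => //; exact: mulrl_measurable.
have sT : Num.sqrt T != 0 by rewrite gt_eqF// sqrtr_gt0.
(* [B 0] vanishes only almost surely, and the law is known for the increment. *)
transitivity (\int[P]_w (expR (q * (B T w - B 0 w)))%:E)%E.
  apply: ge0_ae_eq_integral => //.
  - exact: (measurableT_comp me).
  - exact: (measurableT_comp me).
  - by move: B0; apply: filterS => w /= -> _; rewrite subr0.
pose X : {RV P >-> measurableTypeR R} := HB.pack (fun w => B T w - B 0 w)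
  (isMeasurableFun.Build _ _ _ _ _ mD).
rewrite -(@ge0_integral_distribution _ _ _ _ _ P X
  (fun x => (expR (q * x))%:E)) => [|//|x].
  rewrite (eq_measure_integral (normal_prob 0 (Num.sqrt T))) => [|A mA _].
    by rewrite normal_prob_mgf// mulr0 add0r sqr_sqrtr ?(ltW hT).
  exact: std_BM_terminal_increment.
by rewrite lee_fin expR_ge0.
Qed.

End BrownianMarginal.

(** * From the completed filtration to joint measurability *)

Section Measurability.
Hypothesis P_complete : forall N : set Omega, is_null P N -> measurable N.
Variables (T : R) (B : R -> Omega -> R).
Hypothesis mB : forall t, measurable_fun setT (B t).

(** A set of the completed filtration differs from a measurable [G] by subsets of a null set, which
    are measurable because [P] is complete. *)
Lemma FB_measurable t : FB P B t `<=` measurable.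
Proof.
move=> A [G [sG nAG]].
have mG : measurable G.
  apply: sG; split; first exact: sigma_algebra_measurable.
  move=> _ [s [U [_ [mU ->]]]].
  by rewrite -[X in measurable X]setTI; exact: mB.
have sub N : N `<=` (A `\` G) `|` (G `\` A) -> measurable N.
  move=> NAG; apply: P_complete; have [M [mM [AGM M0]]] := nAG.
  by exists M; split => //; split => //; exact: subset_trans AGM.
have -> : A = (G `\` (G `\` A)) `|` (A `\` G).
  by rewrite setDD; apply/seteqP; split => w /=; have := EM (G w); tauto.
apply: measurableU; last exact/sub/subsetUl.
by apply: measurableD => //; exact/sub/subsetUr.
Qed.

Let D : set (R * Omega) := `[0, T]%classic `*` [set: Omega].

(** The generators are rectangles with measurable sides. Predictable processes are therefore jointly
    measurable, as Tonelli's theorem requires. *)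
Lemma predictable_sets_measurable : predictable_sets P T B `<=` measurable.
Proof.
have mD : measurable D by apply: measurableX.
apply: smallest_sub.
  split => //; first by move=> A; exact: measurableD.
  by move=> A mA; exact: bigcupT_measurable.
move=> _ [[F [/FB_measurable mF ->]]|[s [t [F [_ _ _ /FB_measurable mF ->]]]]].
  by apply: measurableX.
by apply: measurableX.
Qed.

Lemma predictable_measurable (a : R -> Omega -> R) : predictable P T B a ->
  measurable_fun D (fun p => a p.1 p.2).
Proof.
move=> pa _ U mU; have := predictable_sets_measurable _ (pa U mU).
congr (measurable _); apply/seteqP; split => -[t w]/=; rewrite /D/=; tauto.
Qed.

End Measurability.

(** * Measurability of time integrals along paths *)

Section TimeIntegral.
Variables (T : R) (a : R -> Omega -> R).
Let D : set (R * Omega) := `[0, T]%classic `*` [set: Omega].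
Hypothesis ma : measurable_fun D (fun p => a p.1 p.2).

Lemma measurable_path w : measurable_fun `[0, T] (a ^~ w).
Proof.
apply: (@measurable_comp _ _ _ _ _ _ D (fun p => a p.1 p.2) _ (pair^~ w)) => //.
- by apply: measurableX.
- by move=> _ [t tT <-].
- by apply: measurable_funTS; exact: pair2_measurable.
Qed.

(** Tonelli's theorem covers nonnegative integrands. As [g] has no sign, its positive and negative
    parts are integrated separately. *)
Lemma measurable_time_integral (g : R -> R) : measurable_fun setT g ->
  measurable_fun setT (fun w => \int[mu]_(t in `[0%R, T]) (g (a t w))%:E)%E.
Proof.
move=> mg.
have mD : measurable D by apply: measurableX.
have mga : measurable_fun D (fun p => (g (a p.1 p.2))%:E).
  by apply/measurable_EFinP; exact: (measurableT_comp mg).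
have ge0 (h : R -> \bar R) : (forall x, 0 <= h x)%E ->
    measurable_fun D (fun p => h (a p.1 p.2)) ->
    measurable_fun setT (fun w => \int[mu]_(t in `[0%R, T]) h (a t w))%E.
  move=> h0 mh.
  have mhD : measurable_fun setT ((fun p => h (a p.1 p.2)) \_ D).
    exact/(measurable_restrictT _ mD).
  have := @measurable_fun_fubini_tonelli_G _ _ (measurableTypeR R) _ _ mu
    ((fun p => h (a p.1 p.2)) \_ D) mhD.
  rewrite (_ : fubini_G _ _ = (fun w => \int[mu]_(t in `[0%R, T]) h (a t w))%E).
    by apply => p; rewrite patchE; case: ifP.
  apply/funext => w; rewrite [RHS]integral_mkcond; apply: eq_integral => t _.
  by rewrite !patchE /D in_setX in_setT andbT.
pose hp x := maxe (g x)%:E 0%E; pose hn x := maxe (- (g x)%:E)%E 0%E.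
rewrite (_ : (fun w => _) = (fun w => \int[mu]_(t in `[0%R, T]) hp (a t w) -
    \int[mu]_(t in `[0%R, T]) hn (a t w))%E); last first.
  apply/funext => w; rewrite integralE.
  congr (_ - _)%E; apply: eq_integral => t _.
    by rewrite funeposE.
  by rewrite funenegE.
apply: emeasurable_funB; apply: ge0 => [x|]; rewrite ?le_max ?lexx ?orbT//.
- exact: measurable_maxe.
- by apply: measurable_maxe => //; exact: measurableT_comp.
Qed.

End TimeIntegral.
End Model.

(** * Pointwise minimization of the Lagrangian *)

Lemma expR_tangent_le (R : realType) (x y : R) :
  expR y * (1 + (x - y)) <= expR x.
Proof.
rewrite -[x in leRHS](subrK y) expRD mulrC ler_wpM2r ?expR_ge0//.
exact: expR_ge1Dx.
Qed.

(* With the tangent lines of [expR] at [uP] and [uA], the Borch relation makes the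
   first order terms add up to a multiple of the difference of total payoffs. *)
Lemma borch_minimizer (R : realType) (gP gA lam zP zA uP uA : R) :
  0 <= gP -> 0 <= lam ->
  gP * expR (- gP * uP) = lam * (gA * expR (- gA * uA)) ->
  zP + zA <= uP + uA ->
  expR (- gP * uP) + lam * expR (- gA * uA) <=
  expR (- gP * zP) + lam * expR (- gA * zA).
Proof.
move=> gP0 lam0 borch zu.
have hP := expR_tangent_le R (- gP * zP) (- gP * uP).
have := ler_wpM2l lam0 (expR_tangent_le R (- gA * zA) (- gA * uA)).
set eP := expR (- gP * uP) in borch hP *; set eA := expR (- gA * uA) in borch *.
move=> hA.
(* The sum of the two first order terms; [borch] lets it be split between the two tangent lines. *)
have : 0 <= gP * eP * (uP + uA - (zP + zA)).
  by rewrite !mulr_ge0 ?expR_ge0 ?subr_ge0.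
have -> : gP * eP * (uP + uA - (zP + zA)) =
    gP * eP * (uP - zP) + lam * (gA * eA) * (uA - zA) by rewrite -borch; ring.
have -> : gP * eP * (uP - zP) = eP * (1 + (- gP * zP - - gP * uP)) - eP by ring.
have -> : lam * (gA * eA) * (uA - zA) =
  lam * (eA * (1 + (- gA * zA - - gA * uA))) - lam * eA by ring.
lra.
Qed.

(** * Pathwise bound on action minus cost *)

Section Paths.
Context {R : realType}.
Local Notation mu := (@lebesgue_measure R).

Lemma lebesgue_measure_0T (T : R) : 0 < T -> mu `[0%R, T] = T%:E.
Proof. by move=> T0; rewrite lebesgue_measure_itv/= lte_fin T0 oppr0 adde0. Qed.

Lemma integral_0T_cst (T r : R) : 0 < T ->
  (\int[mu]_(t in `[0%R, T]) r%:E = (r * T)%:E)%E.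
Proof. by move=> T0; rewrite integral_cst//= lebesgue_measure_0T// EFinM. Qed.

(** [kappa] is monotone only on the half line. Composed with the positive part it is monotone
    everywhere, hence Borel, and it is unchanged along nonnegative actions. *)
Lemma measurable_nondecreasing_max0 (kappa : R -> R) :
  (forall x y, 0 <= x -> x <= y -> kappa x <= kappa y) ->
  measurable_fun setT (fun x : R => kappa (Num.max x 0)).
Proof.
move=> knd; apply: nondecreasing_measurable => // x y xy.
by apply: knd; [rewrite le_max lexx orbT|rewrite ge_max !le_max xy lexx orbT].
Qed.

Variables (T : R) (f kappa : R -> R).
Hypotheses (hT : 0 < T) (mf : measurable_fun `[0, T] f).
Hypothesis f0 : forall t, 0 <= t <= T -> 0 <= f t.

(** Domination by [1 + f ^+ 2] on an interval of finite length. *)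
Lemma integral_lty_of_sqr :
  (\int[mu]_(t in `[0%R, T]) ((f t) ^+ 2)%:E < +oo)%E ->
  (\int[mu]_(t in `[0%R, T]) (f t)%:E < +oo)%E.
Proof.
move=> f2; apply: (@le_lt_trans _ _
  (\int[mu]_(t in `[0%R, T]) (1%:E + ((f t) ^+ 2)%:E))%E).
  apply: ge0_le_integral => //.
  - exact/measurable_EFinP.
  - by apply: emeasurable_funD => //; apply/measurable_EFinP; exact: measurable_funX.
  - by move=> t _; rewrite -EFinD lee_fin; have := sqr_ge0 (f t - 1); nra.
rewrite ge0_integralD//.
- by rewrite integral_0T_cst// mul1r lte_add_pinfty// ltry.
- by move=> t _; rewrite lee_fin sqr_ge0.
- by apply/measurable_EFinP; exact: measurable_funX.
Qed.

Hypothesis knd : forall x y, 0 <= x -> x <= y -> kappa x <= kappa y.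

Lemma measurable_cost_path : measurable_fun `[0, T] (fun t => kappa (f t)).
Proof.
have : measurable_fun `[0, T] (fun t => kappa (Num.max (f t) 0)).
  exact: (measurableT_comp (measurable_nondecreasing_max0 _ knd)).
apply: eq_measurable_fun => t; rewrite inE/= ?in_itv/= => /f0 ft0.
by rewrite max_l.
Qed.

Variable ks : R.
Hypothesis hks : forall x, 0 <= x -> 1 * x - kappa x <= 1 * ks - kappa ks.
Hypothesis intf : (\int[mu]_(t in `[0%R, T]) (f t)%:E < +oo)%E.

(** The pointwise bound [hks] is integrated over time. Square integrability of the action does not
    control the growth of [kappa], so an infinite cost remains possible and forms a separate
    case. *)
Lemma integral_surplus_le :
  let K := (\int[mu]_(t in `[0%R, T]) (kappa (f t))%:E)%E in
  K = +oo%E \/ (K \is a fin_num /\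
    fine (\int[mu]_(t in `[0%R, T]) (f t)%:E)%E - fine K <= T * (ks - kappa ks)).
Proof.
move=> K; pose h t := (kappa (f t))%:E.
have mh : measurable_fun `[0, T] h by apply/measurable_EFinP; exact: measurable_cost_path.
(* By monotonicity [kappa 0] bounds the cost from below, so only the positive part can have an
   infinite integral. *)
have hn : (\int[mu]_(t in `[0%R, T]) h^\- t < +oo)%E.
  apply: (@le_lt_trans _ _ (\int[mu]_(t in `[0%R, T]) (`|kappa 0|)%:E)%E).
    apply: ge0_le_integral => //; first exact: measurable_funeneg.
    move=> t /=; rewrite ?in_itv/= => /f0 ft0.
    rewrite funenegE ge_max !lee_fin normr_ge0 andbT.
    by rewrite -normrN (le_trans _ (ler_norm _))// lerN2 knd.
  by rewrite integral_0T_cst// ltry.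
have [hp|] := ltP (\int[mu]_(t in `[0%R, T]) h^\+ t)%E +oo%E; last first.
  rewrite leye_eq => /eqP hp; left.
  have hn0 : (0 <= \int[mu]_(t in `[0%R, T]) h^\- t)%E by exact: integral_ge0.
  by rewrite /K integralE hp addye// eqe_oppLR lt_eqF.
right.
have ih : mu.-integrable `[0, T] h.
  apply/integrableP; split => //.
  have -> : (\int[mu]_(t in `[0%R, T]) `|h t| =
      \int[mu]_(t in `[0%R, T]) (h^\+ t + h^\- t))%E.
    by apply: eq_integral => t _; rewrite -[LHS]/((abse \o h) t) fune_abse.
  rewrite ge0_integralD//; first exact: lte_add_pinfty.
  - exact: measurable_funepos.
  - exact: measurable_funeneg.
have if_ : mu.-integrable `[0, T] (EFin \o f).
  apply/integrableP; split; first exact/measurable_EFinP.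
  rewrite (_ : integral _ _ _ = \int[mu]_(t in `[0%R, T]) (f t)%:E)%E//.
  apply: eq_integral => t; rewrite inE/= ?in_itv/= => /f0 ft0.
  by rewrite ger0_norm.
have ic : mu.-integrable `[0, T] (cst (ks - kappa ks)%:E).
  apply/integrableP; split => //.
  by rewrite /= integral_0T_cst// ltry.
have fK : K \is a fin_num by exact: integrable_fin_num.
have ff : (\int[mu]_(t in `[0%R, T]) (f t)%:E)%E \is a fin_num.
  exact: integrable_fin_num.
split => //.
have : (\int[mu]_(t in `[0%R, T]) (f t)%:E <=
        \int[mu]_(t in `[0%R, T]) (h t + cst (ks - kappa ks)%:E t))%E.
  apply: le_integral => //; first exact: integrableD.
  move=> t; rewrite inE/= ?in_itv/= => /f0 /hks ft; rewrite /h/= -EFinD lee_fin; lra.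
rewrite integralD// integral_0T_cst// -/K -(fineK fK) -(fineK ff) -EFinD lee_fin/=; lra.
Qed.

End Paths.

(** * Admissibility, measurability and integrability of contracts *)

Section Contracts.
Context {R : realType} {d : measure_display} {Omega : measurableType d}.
Variable P : probability Omega R.
Local Notation mu := (@lebesgue_measure R).
Hypothesis P_complete : forall N : set Omega, is_null P N -> measurable N.
Variables (T : R) (B : R -> Omega -> R).
Hypotheses (hT : 0 < T) (hB : std_BM P T B).

Lemma std_BM_affine_mgf (r q : R) :
  (\int[P]_w (expR (r + q * B T w))%:E = (expR (r + q ^+ 2 * T / 2))%:E)%E.
Proof.
under eq_integral do rewrite expRD EFinM.
rewrite ge0_integralZl_EFin ?expR_ge0 ?(std_BM_mgf P _ _ hT hB) -?EFinM -?expRD//.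
apply/measurable_EFinP; apply: measurableT_comp => //.
by apply: measurable_funM => //; exact: (std_BM_measurable P _ _ hB).
Qed.

Lemma XT_cst (x0 ks : R) w :
  XT x0 T B (fun _ _ => ks) w = x0 + T * ks + B T w.
Proof. by rewrite /XT integral_0T_cst//= [ks * T]mulrC. Qed.

Lemma costI_cst (kappa : R -> R) (ks : R) (w : Omega) :
  costI kappa T (fun _ _ => ks) w = (T * kappa ks)%:E.
Proof. by rewrite /costI integral_0T_cst// mulrC. Qed.

Lemma H2_cst (ks : R) : 0 <= ks -> H2 P T B (fun _ _ => ks).
Proof.
move=> ks0; split => // [U mU|q q0].
  have [s0 sC _] := smallest_sigma_algebra (`[0, T]%classic `*` [set: Omega])
    [set E | (exists F, FB P B 0 F /\ E = [set 0] `*` F) \/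
             (exists s t F, [/\ 0 <= s, s <= t, t <= T, FB P B s F &
                                E = `]s, t]%classic `*` F])].
  (* The preimage under a constant process is the whole strip or empty. *)
  rewrite /predictable_sets; have [Uks|Uks] := EM (U ks).
    rewrite (_ : [set p : R * Omega | _ /\ U ks] =
        (`[0, T]%classic `*` [set: Omega]) `\` set0).
      exact: sC.
    by rewrite setD0; apply/seteqP; split => -[t w]/=; tauto.
  rewrite (_ : [set p : R * Omega | _ /\ U ks] = set0)//.
  by apply/seteqP; split => -[t w]/=; tauto.
under eq_integral do rewrite integral_0T_cst//=.
by rewrite integral_cst//= probability_setT mule1 ltry.
Qed.

Lemma Wadm_affine (r q : R) : Wadm P T B (fun w => q * B T w + r).
Proof.
split=> [U mU|p p0].
  exists ((fun w => q * B T w + r) @^-1` U); split; last first.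
    by exists set0; split => //; split; [rewrite setDv setU0|rewrite measure0].
  apply: sub_sigma_algebra; exists T, ((fun x => q * x + r) @^-1` U).
  split; first by rewrite lexx ltW.
  split => //; rewrite -[X in measurable X]setTI.
  by apply: measurable_funD => //; exact: mulrl_measurable.
under eq_integral do rewrite mulrDr addrC mulrA.
by rewrite std_BM_affine_mgf ltry.
Qed.

Lemma Wadm_measurable (W : Omega -> R) : Wadm P T B W -> measurable_fun setT W.
Proof.
move=> [mW _] _ U mU; rewrite setTI.
apply: (FB_measurable P P_complete B (std_BM_measurable P _ _ hB) T).
exact: mW.
Qed.

Lemma measurable_XT (x0 : R) (a : R -> Omega -> R) :
  predictable P T B a -> measurable_fun setT (XT x0 T B a).
Proof.
move=> pa; have mB := std_BM_measurable P _ _ hB.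
have ma := predictable_measurable P P_complete T B mB a pa.
apply: measurable_funD => //; apply: measurable_funD => //.
apply: measurableT_comp; first exact: fine_measurable.
by have := measurable_time_integral T a ma id; apply.
Qed.

Lemma measurable_costI (kappa : R -> R) (a : R -> Omega -> R) :
  (forall x y, 0 <= x -> x <= y -> kappa x <= kappa y) -> H2 P T B a ->
  measurable_fun setT (costI kappa T a).
Proof.
move=> knd [pa a0 _]; have mB := std_BM_measurable P _ _ hB.
have ma := predictable_measurable P P_complete T B mB a pa.
have := measurable_time_integral T a ma _ (measurable_nondecreasing_max0 _ knd).
rewrite (_ : (fun w => _) = costI kappa T a)//.
apply/funext => w; apply: eq_integral => t; rewrite inE/= ?in_itv/= => tT.
by rewrite max_l// a0.
Qed.

(** The exponential moment with [q = 1] makes the integral of the squared action finite almost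
    surely. Hence, outside a null set, [fine] in [XT] is not applied to [+oo]. *)
Lemma H2_ae_integrable (a : R -> Omega -> R) : H2 P T B a ->
  {ae P, forall w, (\int[mu]_(t in `[0%R, T]) (a t w)%:E < +oo)%E}.
Proof.
move=> [pa a0 ea]; have mB := std_BM_measurable P _ _ hB.
have ma := predictable_measurable P P_complete T B mB a pa.
have iE : P.-integrable setT (fun w => expeR (1%:E *
    \int[mu]_(t in `[0%R, T]) ((a t w) ^+ 2)%:E)).
  apply/integrableP; split.
    apply: measurableT_comp; first exact: measurable_expeR.
    apply: measurable_funeM.
    exact: (measurable_time_integral T a ma (fun x => x ^+ 2)).
  under eq_integral do rewrite gee0_abs ?expeR_ge0//.
  exact: ea.
apply: filterS (integrable_ae measurableT iE) => w /= /(_ I).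
rewrite mul1e => fin; apply: integral_lty_of_sqr => //.
- exact: measurable_path ma w.
- by move=> t; exact: a0.
- by move: fin; case: integral => // r _; exact: ltry.
Qed.

End Contracts.

(** * The Borch rule, the participation constraint and optimality *)

Section Optimality.
Context {R : realType} {d : measure_display} {Omega : measurableType d}.
Variable P : probability Omega R.
Hypothesis P_complete : forall N : set Omega, is_null P N -> measurable N.
Variables (T : R) (B : R -> Omega -> R).
Hypotheses (hT : 0 < T) (hB : std_BM P T B).
Variables (x0 y0 gP gA : R).
Hypotheses (hgP : 0 < gP) (hgA : 0 < gA).
Variables (kappa : R -> R) (ks : R).
Hypothesis knd : forall x y : R, 0 <= x -> x <= y -> kappa x <= kappa y.
Hypothesis hks0 : 0 <= ks.
Hypothesis hks : forall x : R, 0 <= x -> 1 * x - kappa x <= 1 * ks - kappa ks.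

Let astar : R -> Omega -> R := fun _ _ => ks.
Let c := gP / (gA + gP).
Let betastar := T * gA * gP ^+ 2 / (2 * (gA + gP) ^+ 2) + y0 + T * kappa ks
                - c * (x0 + T * ks).
Let Wlin beta (w : Omega) := c * XT x0 T B astar w + beta.

Let gAP_neq0 : gA + gP != 0. Proof. by rewrite gt_eqF// addr_gt0. Qed.

Lemma Wlin_contractC beta : contractC P T B (Wlin beta) astar.
Proof.
split; last exact: H2_cst.
rewrite (_ : Wlin beta = fun w => c * B T w + (c * (x0 + T * ks) + beta)).
  exact: Wadm_affine.
by apply/funext => w; rewrite /Wlin XT_cst//; ring.
Qed.

(** The agent's net payoff is affine in [B T], so the Gaussian formula applies; [betastar] is the
    constant at which the result is exactly [expR (- gA * y0)]. *)
Lemma agent_disutility_Wlin beta :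
  (\int[P]_w expeR ((- gA)%:E * ((Wlin beta w)%:E - costI kappa T astar w)) =
   (expR (- gA * (y0 + beta - betastar)))%:E)%E.
Proof.
pose r := - gA * (c * (x0 + T * ks) + beta - T * kappa ks).
(* The variance term is [gA] times the first summand of [betastar]. *)
rewrite (_ : - gA * _ = r + (- gA * c) ^+ 2 * T / 2); last first.
  by rewrite /r /betastar /c; field.
rewrite -(std_BM_affine_mgf P _ _ hT hB); apply: eq_integral => w _.
rewrite costI_cst// -EFinB -EFinM/= /Wlin XT_cst//.
by congr (expR _)%:E; rewrite /r; ring.
Qed.

Lemma PC_Wlin beta :
  PC P gA y0 kappa T (Wlin beta) astar <-> betastar <= beta.
Proof.
rewrite /PC integral_ge0N => [|w _]; last exact: expeR_ge0.
rewrite agent_disutility_Wlin /Uexp -EFinN lee_fin lerN2 ler_expR.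
rewrite !mulNr lerN2 ler_pM2l//.
by split; lra.
Qed.

(** For fixed [k] the ratio is an injective function of [w - c * x] alone, so it is constant exactly
    when [w] is affine in [x] with slope [c]. *)
Lemma borch_ratioE (k x w : R) :
  derive1 (Uexp gP) (x - w) / derive1 (Uexp gA) (w - k) =
  gP / gA * expR ((gA + gP) * (w - (c * x + gA * k / (gA + gP)))).
Proof.
rewrite !derive1_Uexp invfM -expRN mulrACA -expRD; congr (_ * expR _).
by rewrite /c; field.
Qed.

Lemma borch_ratio_constP (k : R) (X W : Omega -> R) :
  (exists2 alpha : R, 0 < alpha &
    {ae P, forall w,
      derive1 (Uexp gP) (X w - W w) / derive1 (Uexp gA) (W w - k) = alpha})
  <-> exists beta : R, {ae P, forall w, W w = c * X w + beta}.
Proof.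
have gPA : 0 < gP / gA by exact: divr_gt0.
split=> [[alpha alpha0 h]|[beta h]].
  (* The solution [w - c * x] of [borch_ratioE] with ratio [alpha]. *)
  exists (gA * k / (gA + gP) + ln (alpha / (gP / gA)) / (gA + gP)).
  apply: filterS h => w /=; rewrite borch_ratioE => <-.
  rewrite [gP / gA * _]mulrC mulfK ?gt_eqF// expRK.
  by field.
exists (gP / gA * expR ((gA + gP) * (beta - gA * k / (gA + gP)))).
  by rewrite mulr_gt0// expR_gt0.
apply: filterS h => w /= ->; rewrite borch_ratioE.
by congr (_ * expR (_ * _)); ring.
Qed.

(** [v] and [u] are the disutilities of the agent and of the principal. [v] is extended-valued: it
    is [+oo] where the cost is [+oo]. *)
Let v (W : Omega -> R) (a : R -> Omega -> R) w :=
  expeR ((- gA)%:E * ((W w)%:E - costI kappa T a w)).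
Let u (W : Omega -> R) a w : R := expR (- gP * (XT x0 T B a w - W w)).

Let JprincipalE W a : Jprincipal P gP x0 T B W a = (- \int[P]_w (u W a w)%:E)%E.
Proof.
rewrite -integral_ge0N => [|w _]; last by rewrite lee_fin expR_ge0.
by apply: eq_integral.
Qed.

Let measurable_u W a : contractC P T B W a -> measurable_fun setT (fun w => (u W a w)%:E).
Proof.
move=> [WW [pa _ _]].
apply/measurable_EFinP; apply: measurableT_comp => //.
apply: measurable_funM => //; apply: measurable_funB.
  exact: (measurable_XT P P_complete T B hB).
exact: (Wadm_measurable P P_complete T B hB).
Qed.

Let measurable_v W a : contractC P T B W a -> measurable_fun setT (v W a).
Proof.
move=> [WW Ha].
apply: measurableT_comp; first exact: measurable_expeR.
apply: measurable_funeM; apply: emeasurable_funB.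
  apply/measurable_EFinP; exact: (Wadm_measurable P P_complete T B hB).
exact: (measurable_costI P P_complete T B hB).
Qed.

(* The multiplier of the participation constraint is the Borch ratio of the
   candidate contract. *)
Let lam := gP / gA * expR ((gA + gP) * betastar - gA * (T * kappa ks)).

Lemma lagrangian_le W a : contractC P T B W a ->
  {ae P, forall w,
    ((u (Wlin betastar) astar w)%:E + lam%:E * v (Wlin betastar) astar w <=
     (u W a w)%:E + lam%:E * v W a w)%E}.
Proof.
move=> [WW Ha]; have [pa a0 _] := Ha.
have ma := predictable_measurable P P_complete T B (std_BM_measurable P _ _ hB) a pa.
have lam0 : 0 < lam by rewrite mulr_gt0 ?divr_gt0 ?expR_gt0.
apply: filterS (H2_ae_integrable P P_complete _ _ hT hB a Ha) => w /= inta.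
have a0w t : 0 <= t <= T -> 0 <= a t w by exact: a0.
have := integral_surplus_le _ _ _ hT (measurable_path _ _ ma w) a0w knd ks hks inta.
rewrite -/(costI kappa T a w) => -[Koo|[Kfin surplus]].
  (* An infinite cost makes the right-hand side infinite, since [lam] is positive. *)
  by rewrite [v W a w]/v Koo/= lt0_muleNy ?lte_fin ?oppr_lt0//= gt0_muley// leey.
rewrite /v costI_cst// -(fineK Kfin)/= lee_fin.
apply: borch_minimizer => //; first exact: ltW.
- exact: ltW.
(* The Borch relation holds by the choice of [lam]: the terms in [XT] match because
   [gP * (1 - c) = gA * c]. *)
- have gPAE X Y : gP / gA * X * (gA * Y) = gP * (X * Y) by field; rewrite gt_eqF.
  by rewrite gPAE -expRD; congr (_ * expR _); rewrite /Wlin /c; field.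
(* The wage cancels in the sum of the payoffs, which leaves the bound [surplus]. *)
- rewrite /XT integral_0T_cst//=.
  set A := fine _ in surplus *; set k := fine _ in surplus *.
  lra.
Qed.

Lemma Wlin_optimal W a : contractCPC P T B gA y0 kappa W a ->
  (Jprincipal P gP x0 T B W a <= Jprincipal P gP x0 T B (Wlin betastar) astar)%E.
Proof.
move=> [CWa].
rewrite /PC integral_ge0N => [|w _]; last exact: expeR_ge0.
rewrite /Uexp EFinN leeN2 => pc; rewrite !JprincipalE leeN2.
have Cs := Wlin_contractC betastar.
have lam0 : 0 < lam by rewrite mulr_gt0 ?divr_gt0 ?expR_gt0.
(* Both terms are nonnegative, so the integral splits even when it is infinite. *)
have intuv W' a' : contractC P T B W' a' ->
    (\int[P]_w ((u W' a' w)%:E + lam%:E * v W' a' w) =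
     \int[P]_w (u W' a' w)%:E + lam%:E * \int[P]_w v W' a' w)%E.
  move=> C'; rewrite ge0_integralD//.
  - rewrite ge0_integralZl_EFin ?(ltW lam0)//; last exact: measurable_v.
    by move=> w _; exact: expeR_ge0.
  - by move=> w _; rewrite lee_fin expR_ge0.
  - exact: measurable_u.
  - by move=> w _; rewrite mule_ge0 ?expeR_ge0// lee_fin ltW.
  - by apply: measurable_funeM; exact: measurable_v.
have pos W' a' w : (0 <= (u W' a' w)%:E + lam%:E * v W' a' w)%E.
  by rewrite adde_ge0 ?mule_ge0 ?expeR_ge0 ?lee_fin ?expR_ge0 ?ltW.
have measurable_uv W' a' : contractC P T B W' a' ->
    measurable_fun setT (fun w => (u W' a' w)%:E + lam%:E * v W' a' w)%E.
  move=> C'; apply: emeasurable_funD; first exact: measurable_u.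
  by apply: measurable_funeM; exact: measurable_v.
have := @ae_ge0_le_integral _ _ _ P _ measurableT _ _
  (fun w _ => pos _ _ w) (measurable_uv _ _ Cs)
  (fun w _ => pos _ _ w) (measurable_uv _ _ CWa).
have le : {ae P, forall w, setT w ->
    ((u (Wlin betastar) astar w)%:E + lam%:E * v (Wlin betastar) astar w <=
     (u W a w)%:E + lam%:E * v W a w)%E}.
  by apply: filterS (lagrangian_le _ _ CWa) => w.
move=> /(_ le); rewrite !intuv// agent_disutility_Wlin addrK => hle.
(* The added finite term is the candidate's weighted agent disutility, as its constraint binds; by
   [pc] it also bounds that of the competitor. *)
rewrite -(@leeD2rE _ (lam * expR (- gA * y0))%:E)//.
rewrite EFinM (le_trans hle)// leeD2l// lee_wpmul2l// lee_fin ltW//.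
Qed.

End Optimality.

Theorem theorem3p4 (R : realType) (d : measure_display) (Omega : measurableType d)
  (P : probability Omega R)
  (P_complete : forall N : set Omega, is_null P N -> measurable N)
  (T : R) (hT : 0 < T) (B : R -> Omega -> R) (hB : std_BM P T B)
  (x0 y0 gP gA : R) (hgP : 0 < gP) (hgA : 0 < gA)
  (kappa : R -> R)
  (kappa_sconvex : forall x y l : R, 0 <= x -> 0 <= y -> x != y -> 0 < l < 1 ->
      kappa (l * x + (1 - l) * y) < l * kappa x + (1 - l) * kappa y)
  (kappa_cont : {within `[0, +oo[, continuous kappa})
  (kappa_nondecr : forall x y : R, 0 <= x -> x <= y -> kappa x <= kappa y)
  (kappa_der : forall x : R, 0 < x -> derivable kappa x 1)
  (kappa'_inj : {in `]0, +oo[ &, injective (derive1 kappa)})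
  (ks : R) (hks0 : 0 <= ks)
  (hks : forall x : R, 0 <= x -> 1 * x - kappa x <= 1 * ks - kappa ks) :
  let astar : R -> Omega -> R := fun _ _ => ks in
  let c := gP / (gA + gP) in
  let betastar := T * gA * gP ^+ 2 / (2 * (gA + gP) ^+ 2) + y0 + T * kappa ks
                  - c * (x0 + T * ks) in
  let Wstar := fun w => c * XT x0 T B astar w + betastar in
  (* (i) *)
  (forall W : Omega -> R, Wadm P T B W ->
     ((exists2 alpha : R, 0 < alpha &
        {ae P, forall w,
          derive1 (Uexp gP) (XT x0 T B astar w - W w) /
          derive1 (Uexp gA) (W w - fine (costI kappa T astar w)) = alpha})
      <-> exists beta : R, {ae P, forall w, W w = c * XT x0 T B astar w + beta})) /\
  (forall beta : R,
     contractCPC P T B gA y0 kappa (fun w => c * XT x0 T B astar w + beta) astar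
     <-> betastar <= beta) /\
  (* (ii) *)
  (contractCPC P T B gA y0 kappa Wstar astar /\
   forall (W : Omega -> R) (a : R -> Omega -> R),
     contractCPC P T B gA y0 kappa W a ->
     (Jprincipal P gP x0 T B W a <= Jprincipal P gP x0 T B Wstar astar)%E).
Proof.
move=> astar c betastar Wstar; split; [|split; [|split]].
- move=> W _.
  (* The cost of a constant action is deterministic, so it can serve as the constant [k] of the
     Borch ratio. *)
  have -> : costI kappa T astar = fun=> (T * kappa ks)%:E.
    by apply/funext => w; exact: costI_cst.
  exact: borch_ratio_constP.
- move=> beta; split=> [[_ /PC_Wlin]|le]; first exact.
  by split; [exact: Wlin_contractC|apply/PC_Wlin].
- by split; [exact: Wlin_contractC|apply/PC_Wlin].
- by move=> W a; exact: Wlin_optimal.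
Qed.
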